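(* Let $T$ be a tree on $n$ vertices, let $u$ be a vertex of $T$, and let $A_{Lz}(T_u)$ be the principal submatrix of $A_{Lz}(T)$ obtained by deleting the row and column corresponding to $u$. Then for $\beta>0$, $$S(A_{Lz}(T\setminus u))\leq S(A_{Lz}(T_u))+\beta\leq S(A_{Lz}(T))+2\beta.$$
   Context: Graphs are finite, simple and undirected. For a graph $G$ on $n$ vertices, $d_G(w)$ is the degree of $w$ in $G$ and $d_{\overline{G}}(w)=n-1-d_G(w)$ is its degree in the complement $\overline{G}$. The Lanzhou matrix $A_{Lz}(G)$ is the real symmetric matrix indexed by vertices whose $(w,v)$ entry is $d_G(w)d_{\overline{G}}(w)+d_G(v)d_{\overline{G}}(v)$ if $w$ and $v$ are adjacent in $G$, and $0$ otherwise. For a real symmetric matrix $M$, the spread $S(M)$ is the difference between its largest and smallest eigenvalues. $T\setminus u$ is the graph on $n-1$ vertices obtained from $T$ by deleting the vertex $u$; its Lanzhou matrix is computed in that graph (degrees and complement degrees taken within $T\setminus u$). By contrast, $A_{Lz}(T_u)$ is a submatrix of $A_{Lz}(T)$, with entries computed in $T$. *)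

(* Defs.v *)
From mathcomp Require Import all_boot all_order all_algebra.
From mathcomp Require Import classical_sets reals.

Set Implicit Arguments.
Unset Strict Implicit.
Unset Printing Implicit Defensive.

Import Order.TTheory GRing.Theory Num.Theory.

Local Open Scope ring_scope.

Record sgraph (n : nat) := SGraph {
  adj :> rel 'I_n;
  adj_sym : symmetric adj;
  adj_irr : irreflexive adj }.

Definition deg (n : nat) (G : sgraph n) (w : 'I_n) : nat := #|[pred v | G w v]|.

Fact compl_sym (n : nat) (G : sgraph n) :
  symmetric (fun x y => (x != y) && ~~ G x y).
Proof. by move=> x y; rewrite eq_sym adj_sym. Qed.

Fact compl_irr (n : nat) (G : sgraph n) :
  irreflexive (fun x y => (x != y) && ~~ G x y).
Proof. by move=> x; rewrite eqxx. Qed.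

Definition compl (n : nat) (G : sgraph n) : sgraph n :=
  SGraph (compl_sym G) (compl_irr G).

Lemma deg_compl (n : nat) (G : sgraph n) (w : 'I_n) :
  deg (compl G) w = (n - 1 - deg G w)%N.
Proof.
have <- : #|predC1 w| = (n - 1)%N.
  by have := cardC1 w; rewrite card_ord subn1.
rewrite /deg -(cardID [pred v | G w v] (predC1 w)).
have -> : #|predI (predC1 w) [pred v | G w v]| = #|[pred v | G w v]|.
  apply: eq_card => v; rewrite !inE; case: eqVneq => [->|] //=.
  by rewrite adj_irr.
rewrite addKn; apply: eq_card => v; rewrite !inE /= [w == v]eq_sym.
by rewrite andbC.
Qed.

Fact del_sym (n : nat) (G : sgraph n) (u : 'I_n) :
  symmetric (fun x y => G (lift u x) (lift u y)).
Proof. by move=> x y; exact: adj_sym. Qed.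

Fact del_irr (n : nat) (G : sgraph n) (u : 'I_n) :
  irreflexive (fun x y => G (lift u x) (lift u y)).
Proof. by move=> x; exact: adj_irr. Qed.

(* The vertices other than [u] are renumbered by ['I_n.-1] through [lift u],
   the same renumbering as the one used by [row' u] and [col' u]. *)
Definition del_vertex (n : nat) (G : sgraph n) (u : 'I_n) : sgraph n.-1 :=
  SGraph (del_sym G u) (del_irr G u).

(* In a simple graph a duplicate-free closed walk of size 2 is an edge
   traversed back and forth; the genuine cycles have size at least 3. *)
Definition is_tree (n : nat) (G : sgraph n) : Prop :=
  [/\ (0 < n)%N,
      forall x y : 'I_n, connect G x y
    & forall c : seq 'I_n, ucycle G c -> (size c <= 2)%N].

Definition lanzhou_mx (R : realType) (n : nat) (G : sgraph n) : 'M[R]_n :=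
  \matrix_(w, v)
    if G w v
    then (deg G w * deg (compl G) w + deg G v * deg (compl G) v)%N%:R
    else 0.

(* For a symmetric [M] of positive size the set of eigenvalues is finite and
   nonempty, so [sup] and [inf] are its maximum and minimum. The spread of the
   empty matrix is 0. *)
Definition spread (R : realType) (n : nat) (M : 'M[R]_n) : R :=
  sup [set a | eigenvalue M a]%classic - inf [set a | eigenvalue M a]%classic.

(* Main.v *)
(* The quadratic form of a real symmetric matrix lies between its extreme
   eigenvalues times the squared norm, so spreads can be compared through test
   vectors. The second inequality is Cauchy interlacing: extend by zero. For the
   first, deleting [u] lowers the degree of its neighbours only, and lowers the
   complement degree of its non-neighbours only, so the two nonnegative matrices
   compare entrywise. The absolute values of a test vector then compare the
   largest eigenvalues, and since a tree is bipartite the same vector with signs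
   given by the colouring compares the smallest ones. *)
Require Import Defs.
From mathcomp Require Import all_boot all_order all_algebra.
From mathcomp Require Import sesquilinear spectral complex zify.
From mathcomp Require Import classical_sets reals.

Local Open Scope ring_scope.

Set Implicit Arguments.
Unset Strict Implicit.
Unset Printing Implicit Defensive.

Import Order.TTheory GRing.Theory Num.Theory.

(** * Quadratic forms and extreme eigenvalues *)

Definition qform (R : realType) (n : nat) (M : 'M[R]_n) (x : 'rV[R]_n) : R :=
  (x *m M *m x^T) 0 0.

Lemma qformE (R : realType) n (M : 'M[R]_n) x :
  qform M x = \sum_i \sum_j x 0 i * M i j * x 0 j.
Proof.
rewrite /qform mxE exchange_big; apply: eq_bigr => j _ /=.
by rewrite !mxE mulr_suml.
Qed.

Lemma qform1E (R : realType) n (x : 'rV[R]_n) :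
  qform 1%:M x = \sum_i x 0 i ^+ 2.
Proof.
by rewrite /qform mulmx1 mxE; apply: eq_bigr => i _; rewrite mxE expr2.
Qed.

Lemma qform1_gt0 (R : realType) n (x : 'rV[R]_n) : x != 0 -> 0 < qform 1%:M x.
Proof.
move=> /rV0Pn [i xi]; rewrite qform1E (bigD1 i) //=.
rewrite ltr_pwDl ?exprn_even_gt0 //.
by apply: sumr_ge0 => j _; exact: sqr_ge0.
Qed.

Lemma qform_eigen (R : realType) n (M : 'M[R]_n) a x :
  x *m M = a *: x -> qform M x = a * qform 1%:M x.
Proof. by move=> e; rewrite /qform e -scalemxAl mxE mulmx1. Qed.

Lemma qformN (R : realType) n (M : 'M[R]_n) x : qform (- M) x = - qform M x.
Proof. by rewrite /qform mulmxN mulNmx mxE. Qed.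

Lemma eigenvalueN (F : fieldType) n (M : 'M[F]_n) a :
  eigenvalue (- M) (- a) = eigenvalue M a.
Proof.
apply/eigenvalueP/eigenvalueP => -[x e x0]; exists x => //.
  by apply: oppr_inj; rewrite -mulmxN e scaleNr.
by rewrite mulmxN e scaleNr.
Qed.

(** The spectral theorem diagonalises the complexified matrix by a unitary [P]. In the eigenbasis
    the form is a sum of squared moduli weighted by real eigenvalues, so the largest one bounds
    it. *)
Lemma qform_le_eigenvalue (R : realType) n (M : 'M[R]_n.+1) : M^T = M ->
  exists2 a, eigenvalue M a & forall x, qform M x <= a * qform 1%:M x.
Proof.
move=> Msym; pose phi := real_complex R; pose B := map_mx phi M.
have conjphi r : Num.conj (phi r) = phi r := conjc_real r.
have Breal : B \is a mxOver Num.real.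
  by apply/mxOverP=> i j; rewrite mxE; apply/CrealP/conjphi.
have Bsym : B \is symmetricmx.
  by apply/is_hermitianmxP; rewrite expr0 scale1r map_mx_id // /B map_trmx Msym.
have Bherm := realsym_hermsym Bsym Breal.
have /orthomx_spectralP BE := hermitian_normalmx Bherm.
have /mxOverP dreal := hermitian_spectral_diag_real Bherm.
have Punit := spectral_unit B; have Puni := spectral_unitarymx B.
move: (spectralmx B) (spectral_diag B) BE dreal Punit Puni => P d BE dreal.
move=> Punit Puni.
pose lam j := complex.Re (d 0 j).
have lamE j : phi (lam j) = d 0 j by apply: RRe_real; exact: dreal.
have [j0 _ j0max] := @arg_maxP _ _ _ ord0 xpredT lam isT.
exists (lam j0).
  (* The eigenvector [row j0 P] is complex; the eigenvalue descends to [R] as a root of the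
     characteristic polynomial. *)
  rewrite eigenvalue_root_char -(fmorph_root phi) map_char_poly.
  rewrite -eigenvalue_root_char.
  apply/eigenvalueP; exists (row j0 P).
    rewrite -[X in X *: _]/(phi (lam j0)) lamE [map_mx _ _]BE -row_mul
      !mulmxA mulmxV // mul1mx.
    by rewrite row_mul row_diag_mx -scalemxAl -rowE.
  apply/eqP; rewrite rowE => /(congr1 (mulmx^~ (invmx P))).
  by rewrite mulmxK // mul0mx => /rowP/(_ j0)/eqP; rewrite !mxE !eqxx oner_eq0.
(* [w] holds the coordinates of [x] in the eigenbasis; as [x] is real, its transpose is its
   conjugate transpose. *)
move=> x; pose w := map_mx phi x *m invmx P.
have zE : map_mx phi (x^T) = map_mx Num.conj (map_mx phi x)^T.
  by apply/matrixP=> i j; rewrite !mxE conjphi.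
have wE : P *m map_mx phi (x^T) = map_mx Num.conj w^T.
  rewrite zE /w trmx_mul map_mxM invmx_unitary //.
  by rewrite trmxCK.
have wP : w *m P = map_mx phi x by rewrite /w mulmxKV.
have BwE : map_mx phi x *m invmx P = w by [].
clearbody w.
have phiE (A : 'M[R]_1) : phi (A 0 0) = map_mx phi A 0 0 by rewrite mxE.
have e1 : phi (qform M x) = \sum_j d 0 j * `|w 0 j| ^+ 2.
  rewrite phiE !map_mxM -/B BE !mulmxA BwE -[w *m _ *m _ *m _]mulmxA wE.
  rewrite mul_mx_diag mxE; apply: eq_bigr => j _.
  by rewrite !mxE normCK mulrA [d 0 j * _]mulrC.
have e2 : phi (qform 1%:M x) = \sum_j `|w 0 j| ^+ 2.
  rewrite phiE !map_mxM map_mx1 mulmx1 -wP -mulmxA wE mxE.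
  by apply: eq_bigr => j _; rewrite !mxE normCK.
suff : phi (qform M x) <= phi (lam j0) * phi (qform 1%:M x).
  by rewrite -rmorphM lecR.
rewrite e1 e2 mulr_sumr; apply: ler_sum => j _.
rewrite -lamE ler_wpM2r ?exprn_ge0 //.
by rewrite lecR; exact: j0max.
Qed.

Lemma sup_eigenvalue (R : realType) n (M : 'M[R]_n) a :
    eigenvalue M a -> (forall x, qform M x <= a * qform 1%:M x) ->
  sup [set b | eigenvalue M b]%classic = a.
Proof.
move=> ea aM.
have ub : ubound [set b | eigenvalue M b]%classic a.
  move=> b /eigenvalueP [x e x0].
  by rewrite -(ler_pM2r (qform1_gt0 x0)) -(qform_eigen e).
apply/eqP; rewrite eq_le ge_sup //=; last by exists a.
by apply: ub_le_sup => //; exists a.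
Qed.

Lemma inf_eigenvalue (R : realType) n (M : 'M[R]_n) a :
    eigenvalue M a -> (forall x, a * qform 1%:M x <= qform M x) ->
  inf [set b | eigenvalue M b]%classic = a.
Proof.
move=> ea aM.
have lb : lbound [set b | eigenvalue M b]%classic a.
  move=> b /eigenvalueP [x e x0].
  by rewrite -(ler_pM2r (qform1_gt0 x0)) -(qform_eigen e).
apply/eqP; rewrite eq_le lb_le_inf ?andbT //=; last by exists a.
by apply: ge_inf => //; exists a.
Qed.

(** * Comparing spreads through test vectors *)

Lemma spreadE (R : realType) n (M : 'M[R]_n.+1) : M^T = M ->
  exists a b, [/\ spread M = a - b, eigenvalue M a, eigenvalue M b
    & forall x, b * qform 1%:M x <= qform M x <= a * qform 1%:M x].
Proof.
move=> Msym; have [a ea aM] := qform_le_eigenvalue Msym.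
(* The least eigenvalue of [M] is minus the greatest one of [- M]. *)
have [|b eb bM] := @qform_le_eigenvalue _ _ (- M).
  by rewrite linearN /= Msym.
have eb' : eigenvalue M (- b) by rewrite -eigenvalueN opprK.
have bM' x : - b * qform 1%:M x <= qform M x.
  by rewrite mulNr lerNl -qformN.
exists a, (- b); split=> //; last by move=> x; rewrite bM' aM.
by rewrite /spread (sup_eigenvalue ea aM) (inf_eigenvalue eb' bM').
Qed.

(** [sup] and [inf] of the empty set are both 0 by convention. This case arises when the only vertex
    of a graph is deleted. *)
Lemma spread0 (R : realType) (M : 'M[R]_0) : spread M = 0.
Proof.
suff e : [set a | eigenvalue M a]%classic = set0.
  by rewrite /spread e sup0 inf0 subr0.
rewrite -subset0 => a /eigenvalueP [x _ /eqP []].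
exact: thinmx0.
Qed.

Lemma spread_ge0 (R : realType) n (M : 'M[R]_n) : M^T = M -> 0 <= spread M.
Proof.
case: n M => [|n] M Msym; first by rewrite spread0.
have [a [b [-> _ _ abM]]] := spreadE Msym.
have /andP[lb ub] := abM (delta_mx 0 0).
have x0 : delta_mx 0 0 != 0 :> 'rV[R]_n.+1.
  by apply/rV0Pn; exists 0; rewrite mxE !eqxx oner_eq0.
by rewrite subr_ge0 -(ler_pM2r (qform1_gt0 x0)) (le_trans lb).
Qed.

(** Eigenvectors for the extreme eigenvalues of [M] are traded for vectors of equal norm tested
    against [N]. The sizes may differ, so that principal submatrices are covered. *)
Lemma spread_le (R : realType) m n (M : 'M[R]_m) (N : 'M[R]_n) :
    M^T = M -> N^T = N ->
    (forall x, exists2 y, qform 1%:M y = qform 1%:M x & qform M x <= qform N y) ->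
    (forall x, exists2 y, qform 1%:M y = qform 1%:M x & qform N y <= qform M x) ->
  spread M <= spread N.
Proof.
case: m M => [|m] M Msym Nsym up down; first by rewrite spread0 spread_ge0.
have [a [b [-> /eigenvalueP[x ex x0] /eigenvalueP[y ey y0] _]]] := spreadE Msym.
case: n N Nsym up down => [|n] N Nsym up down.
  (* An eigenvector has positive norm, which no empty vector can match. *)
  have [z ez _] := up x; have := qform1_gt0 x0.
  by rewrite -ez qform1E big_ord0 ltxx.
have [c [d [-> _ _ cdN]]] := spreadE Nsym.
apply: lerB.
  have [z ez] := up x; rewrite (qform_eigen ex) => xz.
  have /andP[_] := cdN z; rewrite ez => /(le_trans xz).
  by rewrite ler_pM2r // qform1_gt0.
have [z ez] := down y; rewrite (qform_eigen ey) => zy.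
have /andP[+ _] := cdN z; rewrite ez => /le_trans/(_ zy).
by rewrite ler_pM2r // qform1_gt0.
Qed.

Lemma principal_submx_sym (T : Type) n (M : 'M[T]_n) (u : 'I_n) :
  M^T = M -> (row' u (col' u M))^T = row' u (col' u M).
Proof. by move=> Msym; apply/matrixP=> i j; rewrite -{2}Msym !mxE. Qed.

(** [P] is the identity without row [u], so [x *m P] is [x] extended by zero at [u], with the same
    norm and the same value of the form. *)
Lemma spread_principal_submx (R : realType) n (M : 'M[R]_n) (u : 'I_n) :
  M^T = M -> spread (row' u (col' u M)) <= spread M.
Proof.
move=> Msym; pose P : 'M[R]_(n.-1, n) := row' u 1%:M.
have PE : row' u (col' u M) = P *m M *m P^T.
  rewrite /P tr_row' trmx1 row'Esub col'Esub mul_rowsub_mx mul1mx.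
  by rewrite mul_rowsub_mx mulmx_colsub mulmx1.
have PP : P *m P^T = 1%:M.
  rewrite /P tr_row' trmx1 row'Esub col'Esub mul_rowsub_mx mul1mx.
  by apply/matrixP=> i j; rewrite !mxE (inj_eq lift_inj).
have q1 x : qform 1%:M (x *m P) = qform 1%:M x.
  by rewrite /qform !mulmx1 trmx_mul mulmxA -[x *m _ *m _]mulmxA PP mulmx1.
have qM x : qform M (x *m P) = qform (row' u (col' u M)) x.
  by rewrite PE /qform trmx_mul !mulmxA.
apply: spread_le => //; first exact: principal_submx_sym.
- by move=> x; exists (x *m P); rewrite ?q1 ?qM.
- by move=> x; exists (x *m P); rewrite ?q1 ?qM.
Qed.

(* Flipping the signs of the entries of [|x|] on one colour class makes every
   term of the quadratic form nonpositive, hence controls the least eigenvalue. *)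
Lemma spread_le_bipartite (R : realType) n (M N : 'M[R]_n) (c : 'I_n -> bool) :
    M^T = M -> N^T = N -> (forall i j, 0 <= M i j <= N i j) ->
    (forall i j, N i j != 0 -> c i != c j) ->
  spread M <= spread N.
Proof.
move=> Msym Nsym MN bip.
have MxN (x : 'rV[R]_n) i j :
    `|x 0 i * M i j * x 0 j| <= `|x 0 i| * N i j * `|x 0 j|.
  have /andP[M0 MNij] := MN i j.
  by rewrite !normrM (ger0_norm M0) ler_wpM2r // ler_wpM2l.
apply: spread_le => // x.
- exists (\row_i `|x 0 i|).
    by rewrite !qform1E; apply: eq_bigr => i _; rewrite mxE real_normK ?num_real.
  rewrite !qformE; apply: ler_sum => i _; apply: ler_sum => j _.
  by rewrite !mxE (le_trans (ler_norm _)).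
- exists (\row_i ((-1) ^+ c i * `|x 0 i|)).
    rewrite !qform1E; apply: eq_bigr => i _.
    by rewrite mxE exprMn sqrr_sign mul1r real_normK ?num_real.
  rewrite !qformE; apply: ler_sum => i _; apply: ler_sum => j _.
  (* Where [N] vanishes so does [M]; elsewhere the colours differ and the two signs multiply to
     -1. *)
  rewrite !mxE; have [N0|/bip cij] := eqVneq (N i j) 0.
    have M0 : M i j = 0 by apply/eqP; rewrite eq_le andbC -{2}N0.
    by rewrite N0 M0 !mulr0 !mul0r.
  rewrite [leLHS](_ : _ = - (`|x 0 i| * N i j * `|x 0 j|)).
    by rewrite lerNl (le_trans _ (MxN x i j)) // -normrN ler_norm.
  by case: (c i) (c j) cij => -[] //= _;
     rewrite ?(expr0, expr1, mul1r, mulN1r, mulNr, mulrN).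
Qed.

(** * Trees are bipartite *)

(* A closed walk that repeats a vertex splits there into two shorter ones. *)
Lemma even_closed_walk n (G : sgraph n) (c : seq 'I_n) :
    (forall p, ucycle G p -> (size p <= 2)%N) -> cycle G c -> ~~ odd (size c).
Proof.
move=> acyc; have [k] := ubnP (size c); elim: k c => // k IHk c sc cyc.
have [uc|/negP uc] := boolP (uniq c).
  have := acyc c; rewrite /ucycle cyc uc => /(_ isT).
  (* Size 1 would be a loop, which leaves sizes 0 and 2. *)
  by case: c cyc {uc sc} => [|x [|y [|z c]]] //=; rewrite adj_irr.
(* Rotating a repeated vertex [x] to the front exhibits the two closed walks [x :: c1] and
   [x :: c2]. *)
have [x [c1 [c2 [i e]]]] : exists x c1 c2 i, rot i c = x :: c1 ++ x :: c2.
  have [x xc] : exists x, (1 < count_mem x c)%N.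
    case: (pickP (fun x => (1 < count_mem x c)%N)) => [x xc|no]; first by exists x.
    case: uc; apply: count_mem_uniq => x; have := no x.
    by rewrite -has_pred1 has_count; case: count => [|[]].
  have xin : x \in c by rewrite -has_pred1 has_count ltnW.
  have [i c' e] := rot_to xin.
  have xc' : x \in c'.
    have /permPl/permP rc := perm_rot i c.
    by move: xc; rewrite -rc e /= eqxx ltnS -has_count has_pred1.
  by case/splitPr: xc' e => c1 c2 e; exists x, c1, c2, i.
rewrite -(size_rot i) e; move: sc cyc; rewrite -(size_rot i) -(rot_cycle i) e.
rewrite /= rcons_cat cat_path /= => sc /and3P[p1 lx p2].
have := IHk (x :: c1); have := IHk (x :: c2).
rewrite /= p2 rcons_path p1 lx; move: sc; rewrite size_cat /= => sc.
by move=> + /(_ _ isT) => /(_ _ isT); lia.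
Qed.

(** The colour of a vertex is the length parity of a chosen walk from the root. For an edge, the
    walk to one end, the edge, and the other walk reversed form a closed walk; its length is even,
    so the two parities differ. *)
Lemma tree_bipartite n (G : sgraph n) : is_tree G ->
  exists c : 'I_n -> bool, forall i j, G i j -> c i != c j.
Proof.
case=> n0 conn acyc; pose r := Ordinal n0.
have walkb v : exists p, path G r p && (v == last r p).
  by have /connectP[p rp ->] := conn r v; exists p; rewrite rp eqxx.
exists (fun v => odd (size (xchoose (walkb v)))) => i j Gij.
have /andP[pi /eqP li] := xchooseP (walkb i).
have /andP[pj /eqP lj] := xchooseP (walkb j).
move: (xchoose _) (xchoose _) pi li pj lj => q p pi li pj lj.
have := @even_closed_walk _ G (r :: p ++ rev q) acyc.
rewrite /= rcons_cat -rev_cons lastI rev_rcons cat_path /= pi -li -lj Gij /=.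
rewrite lj rev_path (eq_path (e' := G)) ?pj => [|x y]; last exact: adj_sym.
by move=> /(_ isT); rewrite size_cat size_rev; lia.
Qed.

(** * Lanzhou matrices under vertex deletion *)

Lemma lanzhou_sym (R : realType) n (G : sgraph n) :
  (lanzhou_mx R G)^T = lanzhou_mx R G.
Proof. by apply/matrixP=> i j; rewrite !mxE adj_sym addnC. Qed.

Lemma deg_del_vertex n (G : sgraph n) (u : 'I_n) w :
  deg G (lift u w) = (G (lift u w) u + deg (del_vertex G u) w)%N.
Proof.
rewrite /deg -!sum1_card !big_mkcond /= (bigD1_ord u) //= inE.
by rewrite [in RHS]big_mkcond; case: (G _ u).
Qed.

(** The products compare factor by factor: deletion lowers the degree by one if the vertex is
    adjacent to [u], and the complement degree by one otherwise, leaving the other factor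
    unchanged. *)
Lemma lanzhou_weight_del_vertex n (G : sgraph n) (u : 'I_n) w :
  (deg (del_vertex G u) w * deg (compl (del_vertex G u)) w
    <= deg G (lift u w) * deg (compl G) (lift u w))%N.
Proof.
rewrite !deg_compl deg_del_vertex.
have : (deg (del_vertex G u) w <= n.-2)%N.
  rewrite -[X in (_ <= X.-1)%N]card_ord -(cardC1 w).
  apply: subset_leq_card; apply/fintype.subsetP=> v; rewrite !inE.
  by apply: contraTneq => ->; rewrite adj_irr.
by case: (G _ u) => /=; move: (deg _ _) => d dn; apply: leq_mul; lia.
Qed.

Theorem theorem24 (R : realType) (n : nat) (T : sgraph n) (hT : is_tree T)
    (u : 'I_n) (beta : R) (hbeta : 0 < beta) :
  spread (lanzhou_mx R (del_vertex T u))
    <= spread (row' u (col' u (lanzhou_mx R T))) + beta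
    <= spread (lanzhou_mx R T) + 2%:R * beta.
Proof.
apply/andP; split; last first.
  rewrite mulr_natl mulr2n addrA lerD2r; apply: ler_wpDr; first exact: ltW.
  by apply: spread_principal_submx; exact: lanzhou_sym.
apply: ler_wpDr; first exact: ltW.
have [c bip] := tree_bipartite hT.
apply: (@spread_le_bipartite _ _ _ _ (c \o lift u)).
- exact: lanzhou_sym.
- exact/principal_submx_sym/lanzhou_sym.
(* Both matrices are supported on the edges avoiding [u], where their entries compare weight by
   weight. *)
- move=> i j; rewrite !mxE /=; case: ifP => _; last by rewrite lexx.
  by rewrite ler0n ler_nat leq_add ?lanzhou_weight_del_vertex.
- by move=> i j; rewrite !mxE /=; case: ifP => [/bip //|_]; rewrite eqxx.
Qed.
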